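(* There exist two constants $\bar\varepsilon>0$ and $C>0$ such that the following holds. Let $\rho$ be a smooth probability density on $[0,1]$, bounded above and bounded away from zero, with $\|\rho'\|_\infty+\|\rho''\|_\infty\le\bar\varepsilon$; let $N\ge1$ and let $(x^1,\dots,x^N)$ be a minimizer of $$F_{N,2}(x^1,\dots,x^N):=\int_0^1\min_{1\le i\le N}|x^i-y|^2\,\rho(y)\,dy .$$ Then $$MK_1(\mu^N,\gamma\rho^{1/3}\,d\theta)\le\frac CN,\qquad\text{where } \mu^N:=\frac1N\sum_{i=1}^N\delta_{x^i},\quad \frac1\gamma:=\int_0^1\rho(\theta)^{1/3}\,d\theta .$$
   Context: For probability measures $\mu,\nu$ on $[0,1]$, $MK_1(\mu,\nu):=\inf_\gamma\int|x-y|\,d\gamma(x,y)$, the infimum being over all probability measures on $[0,1]\times[0,1]$ with marginals $\mu$ and $\nu$. The minimization of $F_{N,2}$ is over $N$-tuples of points of $[0,1]$. *)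

(* Defs.v *)
From HB Require Import structures.
From mathcomp Require Import all_boot all_order all_algebra.
From mathcomp Require Import all_classical all_reals all_analysis.

Set Implicit Arguments.
Unset Strict Implicit.
Unset Printing Implicit Defensive.

Import Order.TTheory GRing.Theory Num.Theory.
Import numFieldNormedType.Exports.

Local Open Scope classical_set_scope.
Local Open Scope ring_scope.

(* Functions on [0, 1] are represented by functions on R; nothing below depends
   on their values outside [0, 1].  In particular derivatives are taken within
   [0, 1], so that they are one-sided at 0 and at 1. *)

Definition diff_quot {R : realType} (f : R -> R) (x : R) : R -> R :=
  fun y => (f y - f x) / (y - x).

Definition within_derivable {R : realType} (f : R -> R) (x : R) : Prop :=
  cvg (diff_quot f x y @[y --> within `[0, 1] x^']).

Definition within_derive {R : realType} (f : R -> R) (x : R) : R :=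
  lim (diff_quot f x y @[y --> within `[0, 1] x^']).

Definition smooth01 {R : realType} (f : R -> R) : Prop :=
  forall (n : nat) (x : R), x \in `[0, 1] ->
    within_derivable (iter n within_derive f) x.

Definition supnorm {R : realType} (f : R -> R) : \bar R :=
  ereal_sup [set `|f x|%:E | x in `[0, 1]].

Definition prob_density {R : realType} (rho : R -> R) : Prop :=
  (forall y : R, y \in `[0, 1] -> 0 <= rho y) /\
  (\int[lebesgue_measure]_(y in `[0%R, 1%R]) (rho y)%:E = 1)%E.

Definition bounded_above {R : realType} (rho : R -> R) : Prop :=
  exists M : R, forall y : R, y \in `[0, 1] -> rho y <= M.

Definition bounded_away_from_zero {R : realType} (rho : R -> R) : Prop :=
  exists2 lambda : R, 0 < lambda &
    forall y : R, y \in `[0, 1] -> lambda <= rho y.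

(* The neutral element +oo of the minimum is never reached when 0 < N. *)
Definition quantF {R : realType} (rho : R -> R) (N : nat) (x : 'I_N -> R)
    : \bar R :=
  (\int[lebesgue_measure]_(y in `[0%R, 1%R])
     ((\big[mine/+oo]_(i < N) (`|x i - y| ^+ 2)%:E) * (rho y)%:E))%E.

Definition quant_minimizer {R : realType} (rho : R -> R) (N : nat)
    (x : 'I_N -> R) : Prop :=
  (forall i, x i \in `[0, 1]) /\
  (forall z : 'I_N -> R, (forall i, z i \in `[0, 1]) ->
     (quantF rho x <= quantF rho z)%E).

(* Measures on [0, 1] are given by their values on the Borel sets of R. *)
Definition empirical {R : realType} (N : nat) (x : 'I_N -> R)
    (A : set R) : \bar R :=
  ((N%:R^-1)%:E * \sum_(i < N) \d_(x i) A)%E.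

Definition density_measure {R : realType} (h : R -> R) (A : set R) : \bar R :=
  (\int[lebesgue_measure]_(t in A `&` `[0%R, 1%R]) (h t)%:E)%E.

Definition limit_constant {R : realType} (rho : R -> R) : R :=
  (\int[lebesgue_measure]_(t in `[0%R, 1%R]) (rho t `^ 3^-1))^-1.

Definition limit_density {R : realType} (rho : R -> R) (t : R) : R :=
  limit_constant rho * rho t `^ 3^-1.

Definition coupling {R : realType} (mu nu : set R -> \bar R)
    (g : probability (measurableTypeR R * measurableTypeR R)%type R) : Prop :=
  [/\ g (`[0, 1] `*` `[0, 1]) = 1%E,
      forall A : set (measurableTypeR R), measurable A ->
        g (fst @^-1` A) = mu A &
      forall A : set (measurableTypeR R), measurable A ->
        g (snd @^-1` A) = nu A].

Definition MK1 {R : realType} (mu nu : set R -> \bar R) : \bar R :=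
  ereal_inf [set (\int[g]_z `|z.1 - z.2|%:E)%E | g in coupling mu nu].

(* Main.v *)
(* Let h_i be the gaps between consecutive points of a (sorted) minimizer and G
   a primitive of rho^(1/3).  Comparing the minimizer with the configuration in
   which one point is translated by the first moment of its Voronoi cell shows
   that every point is the centroid of its cell.  Expanding this relation to
   second order yields, for the increments g_i of G along the points,
   |g_i - g_(i-1)| <= K e h^3 with h the larger of the two gaps involved and e
   the bound on rho' and rho''.  As the gaps sum up to at most 1, all g_i differ
   by at most K' e (max g)^2, hence for small e they are all of order 1/N and
   agree up to O(1/N^2).  Therefore G at the k-th point is k/N times G(1) up to
   O(1/N), that is, the k-th point is O(1/N)-close to the k/N-quantile of the
   limit density. *)

Require Import Defs.
From HB Require Import structures.
From mathcomp Require Import all_boot all_order all_algebra.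
From mathcomp Require Import all_classical all_reals all_analysis.
From mathcomp Require Import perm measurable_realfun ring lra.

Import Order.TTheory GRing.Theory Num.Theory.
Import numFieldNormedType.Exports.

Local Open Scope classical_set_scope.
Local Open Scope ring_scope.

Set Implicit Arguments.
Unset Strict Implicit.

(** * Calculus for integrals of continuous functions over segments *)

Lemma continuous_subr (R : realType) (k : R) : continuous (fun y : R => y - k).
Proof. by move=> y; apply: cvgB; [exact: cvg_id|exact: cvg_cst]. Qed.

Lemma continuousM_fun (R : realType) (f g : R -> R) :
  continuous f -> continuous g -> continuous (fun y => f y * g y).
Proof. by move=> cf cg y; apply: cvgM; [exact: cf|exact: cg]. Qed.

Lemma continuousD_fun (R : realType) (f g : R -> R) :
  continuous f -> continuous g -> continuous (fun y => f y + g y).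
Proof. by move=> cf cg y; apply: cvgD; [exact: cf|exact: cg]. Qed.

Definition itg {R : realType} (f : R -> R) (a b : R) : R :=
  \int[lebesgue_measure]_(y in `[a, b]) f y.

Lemma itg_integrable (R : realType) (f : R -> R) (a b : R) : continuous f ->
  (@lebesgue_measure R).-integrable `[a, b] (EFin \o f).
Proof.
move=> cf; apply: continuous_compact_integrable; first exact: segment_compact.
exact: continuous_subspaceT.
Qed.

Lemma itg_EFin (R : realType) (f : R -> R) (a b : R) : continuous f ->
  (\int[lebesgue_measure]_(y in `[a, b]) (f y)%:E = (itg f a b)%:E)%E.
Proof.
move=> cf; rewrite /itg /Rintegral fineK//.
apply: integrable_fin_num => //; exact: itg_integrable.
Qed.

Lemma itg_chasles (R : realType) (f : R -> R) (a b c : R) : continuous f ->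
  a <= b -> b <= c -> itg f a c = itg f a b + itg f b c.
Proof.
move=> cf ab bc; have := @Rintegral_itvB R f (BLeft a) (BRight c) b.
rewrite !bnd_simp => /(_ (itg_integrable a c cf) ab bc) H.
rewrite /itg -(@Rintegral_itv_obnd_cbnd R b (BRight c)) -?H 1?addrC ?subrK//.
apply: integrableS (itg_integrable b c cf) => //.
exact: subset_itv_oc_cc.
Qed.

Lemma itg_le (R : realType) (f g : R -> R) (a b : R) :
  continuous f -> continuous g ->
  (forall y, a <= y <= b -> f y <= g y) -> itg f a b <= itg g a b.
Proof.
by move=> cf cg fg; apply: le_Rintegral => //; exact: itg_integrable.
Qed.

Lemma eq_itg (R : realType) (f g : R -> R) (a b : R) :
  (forall y, a <= y <= b -> f y = g y) -> itg f a b = itg g a b.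
Proof.
by move=> fg; apply: eq_Rintegral => y; rewrite inE/= in_itv/=; exact: fg.
Qed.

Lemma itgD (R : realType) (f g : R -> R) (a b : R) :
  continuous f -> continuous g ->
  itg (fun y => f y + g y) a b = itg f a b + itg g a b.
Proof. by move=> cf cg; apply: RintegralD => //; exact: itg_integrable. Qed.

Lemma itgZ (R : realType) (k : R) (f : R -> R) (a b : R) : continuous f ->
  itg (fun y => k * f y) a b = k * itg f a b.
Proof. by move=> cf; apply: RintegralZl => //; exact: itg_integrable. Qed.

Lemma itg_point (R : realType) (f : R -> R) (a : R) : itg f a a = 0.
Proof. by rewrite /itg set_itv1 Rintegral_set1. Qed.

Lemma itg_FTC (R : realType) (F p : R -> R) (a b : R) : continuous p ->
  (forall y : R, is_derive y 1 F (p y)) -> a <= b -> itg p a b = F b - F a.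
Proof.
move=> cp dF; rewrite le_eqVlt => /predU1P[->|ab].
  by rewrite itg_point subrr.
have cF : continuous F.
  move=> y; apply: differentiable_continuous; apply/derivable1_diffP.
  by case: (dF y).
rewrite /itg /Rintegral (@continuous_FTC2 R p F)//.
- exact: continuous_subspaceT.
- split=> //.
  + by apply: cvg_at_right_filter; exact: cF.
  + by apply: cvg_at_left_filter; exact: cF.
- by move=> y _; rewrite derive1E; case: (dF y).
Qed.

Lemma itg_cst (R : realType) (c a b : R) : a <= b ->
  itg (fun=> c) a b = c * (b - a).
Proof.
move=> ab; rewrite /itg Rintegral_cst//.
have H : lebesgue_measure `[a, b] = (b - a)%:E.
  rewrite lebesgue_measure_itv/= lte_fin.
  by case: ltP => //= ba; rewrite (_ : b - a = 0)//; lra.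
congr (_ * _); exact: (congr1 fine H).
Qed.

(** Integrate [p - c <= f <= p + c] over the segment and evaluate the integral of [p] by the
    fundamental theorem. *)
Lemma itg_approx (R : realType) (f F p : R -> R) (c a b : R) :
  continuous f -> continuous p -> (forall y : R, is_derive y 1 F (p y)) ->
  a <= b -> (forall y, a <= y <= b -> `|f y - p y| <= c) ->
  `|itg f a b - (F b - F a)| <= c * (b - a).
Proof.
move=> cf cp dF ab fp; rewrite -(itg_FTC cp dF ab).
have cc (k : R) : continuous (fun _ : R => k) by move=> y; exact: cvg_cst.
have cpk k : continuous (fun y => p y + k).
  by move=> y; apply: cvgD; [exact: cp|exact: cc].
have {}fp y : a <= y <= b -> p y + - c <= f y <= p y + c.
  by move=> /fp; rewrite ler_norml; lra.
have : itg (fun y => p y + - c) a b <= itg f a b.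
  by apply: itg_le => // y /fp /andP[].
have : itg f a b <= itg (fun y => p y + c) a b.
  by apply: itg_le => // y /fp /andP[].
rewrite !itgD// !itg_cst// ler_norml mulNr; lra.
Qed.

(** * Algebra of the gap recursion and nearly arithmetic sequences *)

(* The cube root is handled algebraically: b - a is solved for in
   b^3 - a^3 = 3a^2(b - a) + (b - a)^2(2a + b). *)
Lemma cube_root_taylor (R : realFieldType) (a b p e t : R) :
  2^-1 <= a <= 2 -> 2^-1 <= b <= 2 -> 0 <= e <= 1 ->
  `|b ^+ 3 - a ^+ 3| <= e * `|t| ->
  `|b ^+ 3 - a ^+ 3 - p * t| <= e * t ^+ 2 ->
  `|b - (a + p / (3 * a ^+ 2) * t)| <= 16 * e * t ^+ 2.
Proof.
move=> /andP[a1 a2] /andP[b1 b2] /andP[e0 e1] H1 H2.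
have Hq : b ^+ 3 - a ^+ 3 = (b - a) * (a ^+ 2 + a * b + b ^+ 2) by ring.
(* The factor [a^2 + ab + b^2] is at least 3/4, whence the constant 4/3. *)
have ab : `|b - a| <= 4 / 3 * (e * `|t|).
  apply: le_trans (ler_wpM2l _ H1); last by lra.
  rewrite Hq normrM [X in _ * (_ * X)]ger0_norm; last by nra.
  have : 3 / 4 <= a ^+ 2 + a * b + b ^+ 2 by nra.
  have := normr_ge0 (b - a); set w := `|b - a|; nra.
have ab2 : (b - a) ^+ 2 <= 2 * (e * t ^+ 2).
  rewrite -(real_normK (num_real (b - a))) -(real_normK (num_real t)).
  have := normr_ge0 (b - a); have := normr_ge0 t.
  move: ab; set w := `|b - a|; set s := `|t| => ab s0 w0.
  have : w ^+ 2 <= (4 / 3 * (e * s)) ^+ 2 by rewrite ler_pXn2r ?nnegrE//; nra.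
  have : 0 <= e * s ^+ 2 by rewrite mulr_ge0// sqr_ge0.
  have -> : (4 / 3 * (e * s)) ^+ 2 = 16 / 9 * (e * (e * s ^+ 2)) by field.
  nra.
have a3 : 0 < 3 * a ^+ 2 by nra.
have -> : b - (a + p / (3 * a ^+ 2) * t) =
   (b ^+ 3 - a ^+ 3 - p * t - (b - a) ^+ 2 * (2 * a + b)) / (3 * a ^+ 2).
  by field; lra.
rewrite normrM normfV (gtr0_norm a3) ler_pdivrMr//.
apply: (le_trans (ler_normB _ _)).
rewrite [X in _ + X]ger0_norm; last by rewrite mulr_ge0 ?sqr_ge0//; lra.
have h0 : 0 <= e * t ^+ 2 by rewrite mulr_ge0// sqr_ge0.
have : (b - a) ^+ 2 * (2 * a + b) <= 2 * (e * t ^+ 2) * (2 * a + b).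
  by apply: ler_wpM2r => //; lra.
move: H2 h0; set h := e * t ^+ 2; rewrite -[16 * e * _]mulrA -/h => H2 h0 H3.
(* The constant 16 suffices because [1 + 2(2a + b) <= 5 + 4a <= 48a^2] when [b <= 2] and
   [1/2 <= a]. *)
have : h * (1 + 2 * (2 * a + b)) <= h * (16 * (3 * a ^+ 2)).
  apply: ler_wpM2l => //; nra.
nra.
Qed.

(* [u], [v] are the gaps to the left and right of a point, [gl], [gr] the
   corresponding increments of the primitive of [rho^(1/3)], [r^3] the value of
   the density at that point and [d] that of its derivative. *)
Lemma gap_recursion (R : realFieldType) (r d u v e m gl gr : R) :
  0 <= u <= m -> 0 <= v <= m -> m <= u + v -> m <= 1 -> 0 <= e <= 1 ->
  2^-1 <= r -> 2^-1 <= r ^+ 3 -> `|d| <= e ->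
  `|r ^+ 3 * (v ^+ 2 - u ^+ 2) / 8 + d * (v ^+ 3 + u ^+ 3) / 24|
     <= e * m ^+ 4 ->
  `|gr - (r * v + d / (3 * r ^+ 2) * v ^+ 2 / 2)| <= 16 * e * m ^+ 3 ->
  `|gl - (r * u - d / (3 * r ^+ 2) * u ^+ 2 / 2)| <= 16 * e * m ^+ 3 ->
  `|gr - gl| <= 2800 * e * m ^+ 3.
Proof.
move=> /andP[u0 um] /andP[v0 vm] muv m1 /andP[e0 e1] r1 r3 de H Hr Hl.
have m0 : 0 <= m by lra.
(* If both gaps vanish, then [m = 0] and the hypotheses force both increments to be 0; otherwise
   division by [u + v] is possible. *)
have [uv0|uv] := eqVneq (u + v) 0.
  have [Eu Ev] : u = 0 /\ v = 0 by split; lra.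
  have Em : m = 0 by lra.
  move: Hr Hl; rewrite Eu Ev Em !expr0n/= !mulr0 !mul0r !subr0 ?addr0.
  rewrite !normr_le0 => /eqP Er /eqP El.
  by apply/eqP; lra.
have uvp : 0 < u + v by rewrite lt_def uv addr_ge0.
have mp : 0 < m by lra.
(* Since [u^3 + v^3 = (u + v) q], the factor [u + v] divides the whole moment relation. Because
   [m <= u + v], cancelling it lowers the error from order [m^4] to order [m^3]. *)
pose q := v ^+ 2 - u * v + u ^+ 2.
have H' : `|3 * r ^+ 3 * (v - u) + d * q| <= 24 * (e * m ^+ 3).
  rewrite -(ler_pM2r uvp).
  have -> : `|3 * r ^+ 3 * (v - u) + d * q| * (u + v) =
     24 * `|r ^+ 3 * (v ^+ 2 - u ^+ 2) / 8 + d * (v ^+ 3 + u ^+ 3) / 24|.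
    rewrite -{1}(gtr0_norm uvp) -normrM -[X in _ = X * _]ger0_norm//.
    rewrite -normrM.
    by congr `|_|; rewrite /q; field.
  have : e * m ^+ 3 * m <= e * m ^+ 3 * (u + v).
    by rewrite ler_wpM2l// mulr_ge0// exprn_ge0.
  rewrite -mulrA -exprSr; lra.
have e3 : 0 <= e * m ^+ 3 by rewrite mulr_ge0// exprn_ge0.
have e2 : 0 <= e * m ^+ 2 by rewrite mulr_ge0// exprn_ge0.
have e32 : e * m ^+ 3 <= e * m ^+ 2.
  by rewrite [_ ^+ 3]exprSr mulrA; nra.
have q0 : 0 <= q by rewrite /q; nra.
have qm : q <= m ^+ 2 by rewrite /q; nra.
have dq : `|d * q| <= e * m ^+ 2 by rewrite normrM (ger0_norm q0) ler_pM.
(* This bound is of order [m^2] only, but it enters squared, through [d (v - u)^2]. *)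
have vu : `|v - u| <= 17 * (e * m ^+ 2).
  have : 3 * r ^+ 3 * `|v - u| <= 25 * (e * m ^+ 2).
    have p3 : 0 <= 3 * r ^+ 3 by lra.
    rewrite -{1}(ger0_norm p3) -normrM.
    have -> : 3 * r ^+ 3 * (v - u) = (3 * r ^+ 3 * (v - u) + d * q) - d * q.
      by ring.
    apply: (le_trans (ler_normB _ _)); lra.
  have := normr_ge0 (v - u); nra.
have vu2 : `|d| * (v - u) ^+ 2 <= 289 * (e * m ^+ 3).
  rewrite -(real_normK (num_real (v - u))).
  have : `|v - u| ^+ 2 <= (17 * (e * m ^+ 2)) ^+ 2.
    by rewrite ler_pXn2r// nnegrE mulr_ge0.
  have -> : (17 * (e * m ^+ 2)) ^+ 2 = 289 * (e * m ^+ 3) * (e * m) by ring.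
  move=> H2; apply: (@le_trans _ _ (1 * (289 * (e * m ^+ 3) * (e * m)))).
    by rewrite ler_pM// ?sqr_ge0//; lra.
  rewrite mul1r -[leRHS]mulr1.
  by rewrite ler_wpM2l ?mulr_ge0 ?mulr_ile1// exprn_ge0.
have r2 : 1 <= 4 * r ^+ 2 by nra.
(* [A] is [6 r^2] times the difference of the two second-order models of the increments. The
   decisive identity is that [A] equals twice the divided moment relation minus [d (v - u)^2]: this
   is where the exponent 1/3 of the limit density matters. The constant is 337 = 2 * 24 + 289. *)
pose A := 6 * r ^+ 3 * (v - u) + d * (u ^+ 2 + v ^+ 2).
have HA : `|A| <= 337 * (e * m ^+ 3).
  have -> : A = 2 * (3 * r ^+ 3 * (v - u) + d * q) - d * (v - u) ^+ 2.
    by rewrite /A /q; ring.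
  apply: (le_trans (ler_normB _ _)).
  rewrite [X in X + _]normrM [X in _ + X]normrM (ger0_norm (sqr_ge0 _)).
  rewrite ger0_norm//; lra.
have Er : (r * v + d / (3 * r ^+ 2) * v ^+ 2 / 2) -
    (r * u - d / (3 * r ^+ 2) * u ^+ 2 / 2) = A / (6 * r ^+ 2).
  by rewrite /A; field; lra.
have HA' : `|A / (6 * r ^+ 2)| <= 337 * (e * m ^+ 3).
  rewrite normrM normfV [`|6 * _|]ger0_norm; last by lra.
  rewrite ler_pdivrMr; last by lra.
  apply: (le_trans HA); rewrite -[leLHS]mulr1 ler_wpM2l ?mulr_ge0 ?exprn_ge0//.
  lra.
have -> : gr - gl = (gr - (r * v + d / (3 * r ^+ 2) * v ^+ 2 / 2)) -
  (gl - (r * u - d / (3 * r ^+ 2) * u ^+ 2 / 2)) + A / (6 * r ^+ 2).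
  by rewrite -Er; ring.
apply: (le_trans (ler_normD _ _)).
have := ler_normB (gr - (r * v + d / (3 * r ^+ 2) * v ^+ 2 / 2))
  (gl - (r * u - d / (3 * r ^+ 2) * u ^+ 2 / 2)).
move: Hr Hl; rewrite -!mulrA; lra.
Qed.

Lemma finite_argmax (R : realDomainType) (g : nat -> R) (n : nat) : (0 < n)%N ->
  exists2 i, (i < n)%N & forall j, (j < n)%N -> g j <= g i.
Proof.
elim: n => // -[|n] IH _; first by exists 0%N => // -[].
have [//|i ni Hi] := IH; have [gi|gi] := leP (g n.+1) (g i).
  exists i; first exact: leqW.
  by move=> j; rewrite ltnS leq_eqVlt => /predU1P[->//|]; exact: Hi.
exists n.+1 => // j; rewrite ltnS leq_eqVlt => /predU1P[->//|/Hi].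
by move=> /le_trans; apply; exact: ltW.
Qed.

(* The positions [X i] enter the oscillation bound of the increments only
   through a telescoping sum, so that no lower bound on the gaps is needed. *)
Lemma near_arithmetic (R : realFieldType) (n : nat) (X S : nat -> R) (a L : R) :
  (0 < n)%N -> 0 <= a <= 32^-1 -> L <= 2 ->
  (forall i, (i <= n)%N -> 0 <= X i <= 1) ->
  (forall i, (i < n)%N -> 0 <= X i.+1 - X i <= 2 * (S i.+1 - S i)) ->
  (forall i m, (i.+1 < n)%N -> X i.+1 - X i <= m -> X i.+2 - X i.+1 <= m ->
    m <= X i.+2 - X i ->
    `|(S i.+2 - S i.+1) - (S i.+1 - S i)| <= a * m ^+ 3) ->
  0 <= S 0%N <= 3 * (S 1%N - S 0%N) ->
  0 <= L - S n <= 3 * (S n - S n.-1) ->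
  forall k, (k <= n)%N -> `|S k - k%:R * (L / n.+1%:R)| <= 64 / n.+1%:R.
Proof.
move=> n0 /andP[a0 a1] L2 HX HXS HS /andP[S0 S0'] /andP[Sn Sn'] k kn.
pose g i := S i.+1 - S i.
have [i0 i0n gM] := finite_argmax g n0; set M := g i0 in gM.
have g0 i : (i < n)%N -> 0 <= g i by move=> /HXS; rewrite /g; lra.
have M0 : 0 <= M by exact: g0.
have HSle i j : (i <= j)%N -> (j <= n)%N -> S i <= S j.
  move=> ij; rewrite -(subnK ij); elim: (j - i)%N => [|d IH]; first by rewrite add0n.
  rewrite addSn => dn; apply: (le_trans (IH (ltnW dn))).
  by have := g0 _ dn; rewrite /g; lra.
have M2 : M <= 2.
  have := HSle i0.+1 n i0n (leqnn n); have := HSle 0%N i0 (leq0n _) (ltnW i0n).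
  rewrite /M /g; lra.
(* Gaps are at most [2 M], so that [a m^3 <= 4 a M^2 m], where the last factor [m] is at most
   [X i.+2 - X i]. *)
pose c := 4 * a * M ^+ 2.
have c0 : 0 <= c by rewrite /c !mulr_ge0 ?sqr_ge0//.
have step i : (i.+1 < n)%N -> `|g i.+1 - g i| <= c * (X i.+2 - X i).
  move=> iN; have /andP[u0 u1] := HXS _ (ltnW iN); have /andP[v0 v1] := HXS _ iN.
  have gu := gM _ (ltnW iN); have gv := gM _ iN.
  rewrite /g in gu gv.
  pose m := Num.max (X i.+1 - X i) (X i.+2 - X i.+1).
  have um : X i.+1 - X i <= m by rewrite /m le_max lexx.
  have vm : X i.+2 - X i.+1 <= m by rewrite /m le_max lexx orbT.
  have mm : m <= X i.+2 - X i by rewrite /m ge_max; apply/andP; split; lra.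
  have m2 : m <= 2 * M by rewrite /m ge_max; apply/andP; split; lra.
  apply: (le_trans (HS i m iN um vm mm)).
  have m0 : 0 <= m by lra.
  have mM : m ^+ 2 <= 4 * M ^+ 2.
    rewrite (_ : 4 * M ^+ 2 = (2 * M) ^+ 2); last by ring.
    by rewrite ler_pXn2r// nnegrE; lra.
  rewrite /c exprSr mulrA.
  apply: ler_pM => //; first by rewrite mulr_ge0 ?sqr_ge0.
  by rewrite (mulrC 4) -mulrA ler_wpM2l.
(* The sum of [X l.+2 - X l] over [i <= l < j] telescopes to the expression below. It is at most 2
   because the points lie in [[0, 1]], so the increments oscillate by at most [2 c]. *)
have osc i j : (i <= j)%N -> (j < n)%N ->
    `|g j - g i| <= c * (X j.+1 + X j - X i.+1 - X i).
  move=> ij; rewrite -(subnK ij); elim: (j - i)%N => [|d IH].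
    by rewrite add0n subrr normr0 => _; rewrite mulr_ge0//; lra.
  rewrite addSn => dn; have := step _ dn; have := IH (ltnW dn).
  have := ler_normD (g (d + i).+1 - g (d + i)%N) (g (d + i)%N - g i).
  rewrite addrA subrK; lra.
have osc' i : (i < n)%N -> M - 2 * c <= g i.
  move=> iN; have [ij|ji] := leqP i i0.
    have := osc _ _ ij i0n; rewrite ler_norml => /andP[_].
    have := HX _ (ltnW iN); have := HX _ iN; have := HX _ i0n.
    have := HX _ (ltnW i0n); rewrite -/M; nra.
  have := osc _ _ (ltnW ji) iN; rewrite ler_norml => /andP[+ _].
  have := HX _ (ltnW iN); have := HX _ iN; have := HX _ i0n.
  have := HX _ (ltnW i0n); rewrite -/M; nra.
(* Here [a <= 1/32] is used. With [M <= 2] it follows that [2 c <= M / 2]. *)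
have cM : 2 * c <= M ^+ 2 / 4.
  by have := sqr_ge0 M; rewrite /c; nra.
have Sk j : (j <= n)%N -> j%:R * (M - 2 * c) <= S j - S 0%N <= j%:R * M.
  elim: j => [|j IH] jn; first by rewrite !mul0r subrr lexx.
  have := IH (ltnW jn); have := osc' _ jn; have := gM _ jn.
  rewrite /g -(natr1 j); nra.
have n1 : 1 <= n%:R :> R by rewrite ler1n.
(* All increments are at least [M / 2], while their sum is at most [L <= 2]. *)
have nM : n%:R * M <= 4.
  have /andP[+ _] := Sk n (leqnn n).
  have : n%:R * (M / 2) <= n%:R * (M - 2 * c).
    by rewrite ler_wpM2l//; nra.
  lra.
have N0 : 0 < n.+1%:R :> R by rewrite ltr0n.
have kc j : (j <= n)%N -> 0 <= j%:R * (2 * c) <= M.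
  move=> jn; have jr : j%:R <= n%:R :> R by rewrite ler_nat.
  have j0 : 0 <= j%:R :> R by [].
  apply/andP; split; first by rewrite !mulr_ge0.
  have : j%:R * (2 * c) <= n%:R * (M ^+ 2 / 4) by rewrite ler_pM ?mulr_ge0.
  have : n%:R * M * M <= 4 * M by rewrite ler_wpM2r.
  by rewrite expr2; lra.
have gM0 : S 1%N - S 0%N <= M by exact: gM.
have gMn : S n - S n.-1 <= M.
  by have := gM n.-1; rewrite /g prednK//; apply.
(* Each end piece, [S 0] and [L - S n], lies between 0 and [3 M], and the [n] increments sum to a
   value between [n M - M] and [n M]. Thus [L - n.+1 M] lies between [- 2 M] and [5 M]. *)
have HL : `|L - n.+1%:R * M| <= 5 * M.
  have := Sk n (leqnn n); have := kc n (leqnn n).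
  rewrite -natr1 ler_norml; lra.
have HL' : `|k%:R * (L / n.+1%:R) - k%:R * M| <= 5 * M.
  have -> : k%:R * (L / n.+1%:R) - k%:R * M =
      (k%:R / n.+1%:R) * (L - n.+1%:R * M) by field; rewrite lt0r_neq0.
  rewrite normrM; apply: (@le_trans _ _ (1 * (5 * M))); last by rewrite mul1r.
  apply: ler_pM => //; rewrite ger0_norm ?divr_ge0//.
  by rewrite ler_pdivrMr// mul1r ler_nat ltnW.
(* The 8 is 5 from [HL'] plus 3 from the estimate of [S k - k M]. As [1 <= n], the bound [n M <= 4]
   gives [n.+1 M <= 8]. *)
have MN : 8 * M <= 64 / n.+1%:R.
  by rewrite ler_pdivlMr// -natr1; nra.
apply: le_trans MN.
have -> : S k - k%:R * (L / n.+1%:R) =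
  (S k - k%:R * M) - (k%:R * (L / n.+1%:R) - k%:R * M) by ring.
apply: (le_trans (ler_normB _ _)).
have : `|S k - k%:R * M| <= 3 * M.
  have := Sk k kn; have := kc k kn; rewrite ler_norml; lra.
lra.
Qed.

(** * Derivatives within the unit interval and Taylor estimates *)

(** Near [x] the difference quotient stays within 1 of its limit. The constant depends on [x], which
    is enough for continuity. *)
Lemma within_derivable_lip (R : realType) (f : R -> R) (x : R) :
  within_derivable f x ->
  exists K : R, \forall y \near x, y \in `[0, 1] -> `|f y - f x| <= K * `|y - x|.
Proof.
move=> cf; have /cvgrPdist_lt/(_ 1 ltr01) := cf.
set l := lim _ => H; exists (`|l| + 1).
move: H; rewrite !near_withinE; apply: filterS => y H y01.
have [->|yx] := eqVneq y x; first by rewrite !subrr normr0 mulr0.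
have := H yx y01; rewrite /diff_quot => /ltW {}H.
have yx0 : y - x != 0 by rewrite subr_eq0.
rewrite -[f y - f x](divfK yx0) normrM ler_wpM2r//.
have := ler_distD l ((f y - f x) / (y - x)) 0; rewrite !subr0 distrC; lra.
Qed.

Lemma within_derivable_continuous (R : realType) (f : R -> R) :
  (forall x, x \in `[0, 1] -> within_derivable f x) ->
  {within `[0, 1], continuous f}.
Proof.
move=> df; apply/subspace_continuousP => x x01.
have [K HK] := within_derivable_lip (df x x01).
apply/cvgrPdist_lt => e e0; rewrite near_withinE.
have K0 : 0 < `|K| + 1 by rewrite ltr_pwDr.
near=> y => y01.
have : `|f y - f x| <= K * `|y - x| by move: y01; near: y.
rewrite distrC => /le_lt_trans; apply.
apply: (@le_lt_trans _ _ ((`|K| + 1) * `|y - x|)).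
  by rewrite ler_wpM2r// (le_trans (ler_norm K))// lerDl.
rewrite mulrC -ltr_pdivlMr// distrC; clear y01; near: y.
by apply: cvgr_dist_lt; [exact: cvg_id|rewrite divr_gt0].
Unshelve. all: by end_near. Qed.

(** Near an interior point the restriction to [[0, 1]] is void, so the one limit becomes the other
    under the translation [y = h + x]. *)
Lemma within_derive_is_derive (R : realType) (f : R -> R) (x : R) :
  x \in `]0, 1[ -> within_derivable f x ->
  is_derive x 1 f (within_derive f x).
Proof.
move=> x01 cf.
have Hc : (fun h : R => h^-1 *: (f (h *: 1 + x) - f x)) @ 0^' -->
    within_derive f x.
  have E : (fun h : R => h^-1 *: (f (h *: 1 + x) - f x)) =1
      diff_quot f x \o (fun h => h + x).
    move=> h; rewrite /diff_quot/= /GRing.scale/= mulr1 addrK.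
    by rewrite mulrC.
  rewrite (funext E); apply: (cvg_comp _ _ _ cf).
  move=> A HA.
  have {}HA : \forall y \near x,
      y != x -> `[0, 1]%classic y -> A (diff_quot f x y) by exact: HA.
  have /(filterI HA) {}HA : \forall y \near x, y \in `]0, 1[.
    exact: near_in_itvoo.
  have : (h + x) @[h --> (0 : R)] --> x.
    by rewrite -[X in _ --> X]add0r; apply: cvgD; [exact: cvg_id|exact: cvg_cst].
  move=> /(_ _ HA) {}HA.
  have {}HA : \forall h \near (0 : R),
     (h + x != x -> `[0, 1]%classic (h + x) -> A (diff_quot f x (h + x))) /\
     h + x \in `]0, 1[ by exact: HA.
  suff : \forall h \near (0 : R), h != 0 -> A (diff_quot f x (h + x)) by [].
  apply: filterS HA => h /= [H hx] h0; apply: H.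
    by rewrite -subr_eq0 addrK.
  by move: hx; rewrite !in_itv/= => /andP[/ltW -> /ltW ->].
apply: DeriveDef; first by apply/cvg_ex; exists (within_derive f x).
exact/cvg_lim.
Qed.

(** The localization [|c - x| <= |y - x|] is what makes a second application, to the derivative,
    yield a quadratic remainder. Both orders of [x] and [y] are needed, since a cell extends to both
    sides of its point. *)
Lemma within_MVT (R : realType) (f : R -> R) (x y : R) :
  (forall x, x \in `[0, 1] -> within_derivable f x) ->
  0 <= x <= 1 -> 0 <= y <= 1 ->
  exists c, [/\ 0 <= c <= 1, `|c - x| <= `|y - x| &
    f y - f x = within_derive f c * (y - x)].
Proof.
move=> df.
have main (u v : R) : 0 <= u -> u <= v -> v <= 1 -> exists2 c, c \in `[u, v] &
    f v - f u = within_derive f c * (v - u).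
  move=> u0 uv v1; apply: MVT_segment => //.
    move=> z; rewrite in_itv/= => /andP[uz zv]; apply: within_derive_is_derive.
      by rewrite in_itv/=; lra.
    by apply: df; rewrite in_itv/=; lra.
  apply: continuous_subspaceW (within_derivable_continuous df) => z/=.
  by rewrite !in_itv/=; lra.
move=> /andP[x0 x1] /andP[y0 y1]; have [xy|/ltW yx] := leP x y.
  have [c] := main _ _ x0 xy y1; rewrite in_itv/= => /andP[xc cy] ->.
  exists c; split=> //; first lra.
  by rewrite !ger0_norm; lra.
have [c] := main _ _ y0 yx x1; rewrite in_itv/= => /andP[yc cx] E.
exists c; split=> //; first lra.
  by rewrite !ler0_norm; lra.
by rewrite -[LHS]opprB E -mulrN opprB.
Qed.

Lemma supnorm_ge (R : realType) (f : R -> R) (x : R) :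
  0 <= x <= 1 -> (`|f x|%:E <= supnorm f)%E.
Proof. by move=> x01; apply: ereal_sup_ubound; exists x => //=; rewrite in_itv. Qed.

(** The two norms are nonnegative, so each is at most [e]. The mean value theorem is then applied
    once, or twice for the quadratic remainder, without the factor 1/2. *)
Lemma smooth_taylor (R : realType) (f : R -> R) (e : R) : smooth01 f ->
  (supnorm (within_derive f) + supnorm (within_derive (within_derive f))
     <= e%:E)%E ->
  [/\ forall x, 0 <= x <= 1 -> `|within_derive f x| <= e,
      forall x y, 0 <= x <= 1 -> 0 <= y <= 1 -> `|f y - f x| <= e * `|y - x| &
      forall x y, 0 <= x <= 1 -> 0 <= y <= 1 ->
        `|f y - f x - within_derive f x * (y - x)| <= e * (y - x) ^+ 2].
Proof.
move=> sf He.
have x01 : (0 <= (0 : R)) && (0 <= (1 : R)) by rewrite lexx ler01.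
have s0 (g : R -> R) : (0 <= supnorm g)%E.
  by apply: le_trans (supnorm_ge g x01); rewrite lee_fin.
have d1 x : 0 <= x <= 1 -> `|within_derive f x| <= e.
  move=> /supnorm_ge H; rewrite -lee_fin; apply: le_trans He.
  by apply: (le_trans (H _)); rewrite leeDl.
have d2 x : 0 <= x <= 1 -> `|within_derive (within_derive f) x| <= e.
  move=> /supnorm_ge H; rewrite -lee_fin; apply: le_trans He.
  by apply: (le_trans (H _)); rewrite leeDr.
have sf0 := sf 0%N; have sf1 := sf 1%N.
split=> // x y hx hy.
  have [c [hc _ ->]] := within_MVT sf0 hx hy.
  by rewrite normrM ler_wpM2r// d1.
have [c [hc cx ->]] := within_MVT sf0 hx hy.
have [c' [hc' _ E]] := within_MVT sf1 hx hc.
rewrite -mulrBl E -mulrA normrM -(real_normK (num_real (y - x))) expr2.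
rewrite ler_pM//; first by exact: d2.
by rewrite normrM ler_wpM2r.
Qed.

(** * The quantization cost and the centroid condition *)

(** The default 1 replaces [+oo] to keep the minimum real-valued; squared distances within [[0, 1]]
    never exceed it. *)
Definition min_sqdist {R : realType} (N : nat) (x : 'I_N -> R) (y : R) : R :=
  \big[Num.min/1]_(i < N) (`|x i - y| ^+ 2).

Lemma min_sqdist_le (R : realType) (N : nat) (x : 'I_N -> R) (y : R) i :
  min_sqdist x y <= `|x i - y| ^+ 2.
Proof. exact: bigmin_le_cond. Qed.

Lemma le_min_sqdist (R : realType) (N : nat) (x : 'I_N -> R) (y v : R) :
  v <= 1 -> (forall i, v <= `|x i - y| ^+ 2) -> v <= min_sqdist x y.
Proof. by move=> v1 H; apply/bigmin_geP; split. Qed.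

Lemma min_sqdist_continuous (R : realType) (N : nat) (x : 'I_N -> R) :
  continuous (min_sqdist x).
Proof.
rewrite /min_sqdist => y; elim: (index_enum _) => [|i s IH].
  under eq_fun do rewrite big_nil; exact: cvg_cst.
under eq_fun do rewrite big_cons.
apply: (continuous_min _ IH).
apply: (@continuousM R R (fun y => `|x i - y|) (fun y => `|x i - y|));
  apply: continuous_comp; [|exact: norm_continuous| |exact: norm_continuous];
  by apply: continuousB; [exact: cst_continuous|exact: cvg_id].
Qed.

Lemma quantF_itg (R : realType) (rho rho' : R -> R) (N : nat) (x : 'I_N -> R) :
  (0 < N)%N -> continuous rho' -> (forall y, 0 <= y <= 1 -> rho y = rho' y) ->
  (forall i, 0 <= x i <= 1) ->
  quantF rho x = (itg (fun y => min_sqdist x y * rho' y) 0 1)%:E.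
Proof.
move=> N0 cr Er x01; rewrite -itg_EFin; last first.
  by move=> y; apply: continuousM; [exact: min_sqdist_continuous|exact: cr].
apply: eq_integral => y; rewrite inE/= in_itv/= => y01; rewrite Er// EFinM.
congr (_ * _)%E.
have E (s : seq 'I_N) :
    mine 1%:E (\big[mine/+oo%E]_(i <- s) (`|x i - y| ^+ 2)%:E) =
    (\big[Num.min/1]_(i <- s) `|x i - y| ^+ 2)%:E.
  elim: s => [|i s IH]; first by rewrite !big_nil; apply/min_idPl; rewrite leey.
  by rewrite !big_cons minCA IH EFin_min.
rewrite -E; apply/esym/min_idPr.
(* A nonempty family has a term at most 1, so taking the minimum with 1 changes nothing. *)
pose i0 := Ordinal N0.
rewrite (bigD1 i0)//= ge_min lee_fin; apply/orP; left.
by rewrite exprn_ile1// ler_norml; have := x01 i0; lra.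
Qed.

(** Its vanishing is the centroid condition for [c] in the cell [[a, b]]. *)
Definition first_moment {R : realType} (rho : R -> R) (c a b : R) : R :=
  itg (fun y => (y - c) * rho y) a b.

(* Moving the point [x i] by the first moment [m] of its cell changes the cost
   by at most [- 2 m^2 + m^2], since the cell has mass at most 1. *)
Lemma minimizer_first_moment (R : realType) (rho rho' : R -> R) (N : nat)
    (x : 'I_N -> R) (i : 'I_N) (a b : R) :
  continuous rho' -> (forall y, 0 <= y <= 1 -> rho y = rho' y) ->
  (forall y, 0 <= rho' y) -> itg rho' 0 1 = 1 ->
  quant_minimizer rho x ->
  0 <= a -> a <= b -> b <= 1 ->
  (forall y, a <= y <= b -> forall j, `|x i - y| <= `|x j - y|) ->
  (0 < a -> exists2 j, j != i &
     forall y, 0 <= y <= a -> `|x j - y| <= `|x i - y|) ->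
  (b < 1 -> exists2 j, j != i &
     forall y, b <= y <= 1 -> `|x j - y| <= `|x i - y|) ->
  first_moment rho' (x i) a b = 0.
Proof.
move=> cr Er r0 r1 [x01 xmin] a0 ab b1 Hcell Ha Hb.
have N0 : (0 < N)%N by rewrite (leq_ltn_trans _ (ltn_ord i)).
have {}x01 j : 0 <= x j <= 1 by have := x01 j; rewrite in_itv.
have cc (k : R) : continuous (fun _ : R => k) by exact: cst_continuous.
have cid := @continuous_subr R.
have cM := @continuousM_fun R.
have cA := @continuousD_fun R.
have cD z : continuous (fun y => @min_sqdist R N z y * rho' y).
  by apply: cM => //; exact: min_sqdist_continuous.
rewrite /first_moment.
set m := itg _ a b; set M := itg rho' a b.
have M0 : 0 <= M.
  rewrite -[0](mul0r (b - a)) -(itg_cst 0 ab); apply: itg_le => //.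
have M1 : M <= 1.
  rewrite -r1 (itg_chasles cr a0 (le_trans ab b1)) (itg_chasles cr ab b1) -/M.
  have : 0 <= itg rho' 0 a.
    by rewrite -[0 in leLHS](mul0r (a - 0)) -(itg_cst 0 a0); apply: itg_le.
  have : 0 <= itg rho' b 1.
    by rewrite -[0 in leLHS](mul0r (1 - b)) -(itg_cst 0 b1); apply: itg_le.
  lra.
(* The competitor must stay in [[0, 1]]: on the cell [y - x i] lies between [- x i] and [1 - x i],
   and the cell has mass at most 1. *)
have mlo : - x i <= m.
  have : (- x i) * M <= m.
    rewrite -itgZ//; apply: itg_le; [by apply: cM|by apply: cM|].
    by move=> y yab; rewrite ler_wpM2r//; lra.
  by have := x01 i; nra.
have mhi : m <= 1 - x i.
  have : m <= (1 - x i) * M.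
    rewrite -itgZ//; apply: itg_le; [by apply: cM|by apply: cM|].
    by move=> y yab; rewrite ler_wpM2r//; lra.
  by have := x01 i; nra.
pose z j := if j == i then x i + m else x j.
have z01 j : 0 <= z j <= 1.
  by rewrite /z; case: eqP => _ //; apply/andP; split; lra.
have : itg (fun y => min_sqdist x y * rho' y) 0 1 <=
       itg (fun y => min_sqdist z y * rho' y) 0 1.
  rewrite -lee_fin -(quantF_itg N0 cr Er x01) -(quantF_itg N0 cr Er z01).
  by apply: xmin => j; rewrite in_itv/=; exact: z01.
rewrite !(itg_chasles (cD _) a0 (le_trans ab b1)) !(itg_chasles (cD _) ab b1).
(* Outside the cell another, unmoved point is at least as near as [x i], so the move cannot raise
   the cost there. *)
have out (y : R) j : 0 <= y <= 1 -> j != i -> `|x j - y| <= `|x i - y| ->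
    min_sqdist z y * rho' y <= min_sqdist x y * rho' y.
  move=> y01 ji Hj; rewrite ler_wpM2r//; apply: le_min_sqdist.
    apply: (le_trans (min_sqdist_le z y i)).
    by rewrite exprn_ile1// ler_norml; have := z01 i; lra.
  move=> k; have [->|ki] := eqVneq k i.
    apply: (le_trans (min_sqdist_le z y j)); rewrite /z (negbTE ji).
    by rewrite ler_pXn2r// nnegrE.
  by apply: (le_trans (min_sqdist_le z y k)); rewrite /z (negbTE ki).
have left : itg (fun y => min_sqdist z y * rho' y) 0 a <=
            itg (fun y => min_sqdist x y * rho' y) 0 a.
  move: a0; rewrite le_eqVlt => /predU1P[<-|/[dup]ap /Ha[j ji Hj]].
    by rewrite !itg_point.
  by apply: itg_le => // y ya; apply: (out y j) => //; [lra|exact: Hj].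
have right : itg (fun y => min_sqdist z y * rho' y) b 1 <=
             itg (fun y => min_sqdist x y * rho' y) b 1.
  move: b1; rewrite le_eqVlt => /predU1P[->|/[dup]bp /Hb[j ji Hj]].
    by rewrite !itg_point.
  by apply: itg_le => // y ya; apply: (out y j) => //; [lra|exact: Hj].
(* In the cell the new cost is at most the squared distance to [x i + m]. In [- 2 * m * m] one
   factor is the translation and the other the first moment. *)
have mid : itg (fun y => min_sqdist z y * rho' y) a b <=
    itg (fun y => min_sqdist x y * rho' y) a b + (- 2 * m * m + m ^+ 2 * M).
  have c1 : continuous (fun y => (y - x i) * rho' y) by exact: cM.
  have c2 : continuous (fun y => - 2 * m * ((y - x i) * rho' y)) by exact: cM.
  have c3 : continuous (fun y => m ^+ 2 * rho' y) by exact: cM.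
  have c4 : continuous (fun y => - 2 * m * ((y - x i) * rho' y) + m ^+ 2 * rho' y).
    exact: cA.
  have -> : - 2 * m * m + m ^+ 2 * M =
      itg (fun y => - 2 * m * ((y - x i) * rho' y) + m ^+ 2 * rho' y) a b.
    by rewrite itgD// !itgZ.
  rewrite -itgD//; apply: itg_le => //.
    exact: cA.
  move=> y yab; rewrite !mulrA -!mulrDl ler_wpM2r//.
  apply: (le_trans (min_sqdist_le z y i)); rewrite /z eqxx -/m.
  apply: (@le_trans _ _ (`|x i - y| ^+ 2 + (- 2 * m * (y - x i) + m ^+ 2))).
    rewrite !real_normK ?num_real//.
    by rewrite le_eqVlt; apply/orP; left; apply/eqP; ring.
  rewrite lerD2r; apply: le_min_sqdist => [|j].
    by rewrite exprn_ile1// ler_norml; have := x01 i; lra.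
  by rewrite ler_pXn2r ?nnegrE//; exact: Hcell.
move=> H; have : m ^+ 2 <= 0 by nra.
by move=> m2; apply/eqP; rewrite -sqrf_eq0 eq_le m2 sqr_ge0.
Qed.

(** * A coupling that sends each quantile interval to one point *)

Section step_coupling.
Context {R : realType} (h : R -> R).
Hypotheses (ch : continuous h) (h0 : forall y, 0 <= h y).
Notation mu := (@lebesgue_measure R).

Let dens (A : set (measurableTypeR R)) : \bar R := (\int[mu]_(y in A) (h y)%:E)%E.

Let mh (D : set (measurableTypeR R)) : measurable_fun D h.
Proof.
by apply: measurable_funTS; exact: continuous_measurable_fun.
Qed.

Let dens0 : dens set0 = 0%E. Proof. exact: integral_set0. Qed.

Let dens_ge0 A : (0 <= dens A)%E.
Proof. by apply: integral_ge0 => y _; rewrite lee_fin. Qed.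

Let dens_sigma_additive : semi_sigma_additive dens.
Proof.
move=> F mF tF mUF; rewrite /dens; apply: cvg_toP.
  apply: ereal_nondecreasing_is_cvgn => m n mn.
  apply: lee_sum_nneg_natr => // k _ _.
  by apply: integral_ge0 => y _; rewrite lee_fin.
rewrite ge0_integral_bigcup//=; last by move=> y _; rewrite lee_fin.
exact/measurable_EFinP.
Qed.

HB.instance Definition _ := isMeasure.Build _ _ _ dens
  dens0 dens_ge0 dens_sigma_additive.

Let mpair (c : R) : measurable_fun [set: measurableTypeR R]
  (fun y : measurableTypeR R => (c : measurableTypeR R, y)).
Proof. by apply: measurable_fun_pair. Qed.

(** The product of the Dirac mass at [c] and the density restricted to [[a, b]], obtained as a
    pushforward along [y |-> (c, y)]. *)
Let piece (c a b : R) :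
    {measure set (measurableTypeR R * measurableTypeR R)%type -> \bar R} :=
  measure_function_pushforward__canonical__measure_function_Measure
    (measure_function_mrestr__canonical__measure_function_Measure
       dens (measurable_itv `[a, b])) (mpair c).

Variables (N : nat) (x q : nat -> R) (c : R).
Hypotheses (N0 : (0 < N)%N) (c0 : 0 <= c).
Hypotheses (q0 : q 0%N = 0) (qN : q N = 1).
Hypothesis q_le : forall k, (k < N)%N -> q k <= q k.+1.
Hypothesis q_mass : forall k, (k < N)%N -> itg h (q k) (q k.+1) = N%:R^-1.
Hypothesis x01 : forall k, (k < N)%N -> 0 <= x k <= 1.
Hypothesis x_near : forall k y, (k < N)%N -> q k <= y <= q k.+1 ->
  `|x k - y| <= c.

Let step : {measure set (measurableTypeR R * measurableTypeR R)%type -> \bar R} :=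
  msum (fun k => piece (x k) (q k) (q k.+1)) N.

Let stepE B : step B =
  (\sum_(k < N) \int[mu]_(y in [set y | B (x k, y)] `&` `[q k, q k.+1]) (h y)%:E)%E.
Proof. by []. Qed.

Let step_fst (A : set R) : step (fst @^-1` A) =
  empirical (fun k : 'I_N => x k) A.
Proof.
rewrite stepE /empirical ge0_sume_distrr//.
apply: eq_bigr => k _; rewrite diracE.
have [xA|xA] := boolP (x k \in A).
  rewrite (_ : [set _ | _] = setT); last first.
    by apply/seteqP; split=> // y _ /=; exact: set_mem.
  by rewrite setTI itg_EFin// q_mass// mule1.
rewrite (_ : [set _ | _] = set0); last first.
  by apply/seteqP; split=> // y /= /mem_set; rewrite (negbTE xA).
by rewrite set0I integral_set0 mule0.
Qed.

Let q01 k : (k <= N)%N -> 0 <= q k <= 1.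
Proof.
have mono i j : (i <= j)%N -> (j <= N)%N -> q i <= q j.
  move=> ij; rewrite -(subnK ij); elim: (j - i)%N => [|d IH]; first by rewrite add0n.
  by rewrite addSn => dn; apply: (le_trans (IH (ltnW dn))); exact: q_le.
by move=> kN; rewrite -{1}q0 -qN !mono.
Qed.

Let step_snd (A : set (measurableTypeR R)) : measurable A ->
  step (snd @^-1` A) = density_measure h A.
Proof.
move=> mA; rewrite stepE /density_measure -q0 -qN.
suff main n : (n <= N)%N ->
    (\sum_(k < n) \int[mu]_(y in A `&` `[q k, q k.+1]) (h y)%:E)%E =
    (\int[mu]_(y in A `&` `[q 0%N, q n]) (h y)%:E)%E by exact: main.
elim: n => [|n IH] nN.
  (* The empty sum faces an integral over at most one point, which vanishes. *)
  rewrite big_ord0 set_itv1; apply/esym/eqP.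
  rewrite eq_le; apply/andP; split; last first.
    by apply: integral_ge0 => y _; rewrite lee_fin.
  rewrite -(@integral_set1 R (EFin \o h) (q 0%N)).
  apply: ge0_subset_integral.
  - exact: measurableI.
  - exact: measurable_set1.
  - exact/measurable_EFinP.
  - by move=> y _; rewrite lee_fin.
  - by move=> y [].
rewrite big_ord_recr/= IH; last exact: ltnW.
have [/andP[q1 _] /andP[_ q2]] := (q01 (ltnW nN), q01 nN).
have qq := q_le nN.
have -> : A `&` `[q 0%N, q n.+1] =
    (A `&` `[q 0%N, q n]) `|` (A `&` `]q n, q n.+1]).
  rewrite -setIUr; congr (_ `&` _).
  rewrite -itv_bndbnd_setU// bnd_simp ?q0//.
rewrite ge0_integral_setU//=; last 5 first.
- exact: measurableI.
- exact: measurableI.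
- exact/measurable_EFinP.
- by move=> y _; rewrite lee_fin.
- apply/disj_setPS => y [[_ /=]]; rewrite !in_itv/= => /andP[_ yq] [_].
  by rewrite ltNge yq.
congr (_ + _)%E.
(* Consecutive closed intervals share an endpoint. Moving [A] into the integrand allows the
   half-open interval to be closed at no cost. *)
rewrite setIC [in RHS]setIC !integral_mkcondr.
rewrite integral_itv_obnd_cbnd//.
apply/measurable_restrict; [exact: mA|exact: measurable_itv|].
by apply/measurable_EFinP; exact: mh.
Qed.

Let sum_inv : (\sum_(k < N) (N%:R^-1 : R)%:E = 1)%E.
Proof.
rewrite sumEFin sumr_const card_ord -[_ *+ N]mulr_natr mulVf//.
by rewrite pnatr_eq0 -lt0n.
Qed.

Let step_square : step (`[0, 1] `*` `[0, 1]) = 1%E.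
Proof.
rewrite stepE (eq_bigr (fun=> (N%:R^-1)%:E)) => [|k _].
  exact: sum_inv.
rewrite -(q_mass (ltn_ord k)) -itg_EFin//; congr integral.
apply/seteqP; split=> [y []//|y /= yq]; split=> //=.
have := x01 (ltn_ord k); rewrite !in_itv/= => ->; split=> //.
have := q01 (ltnW (ltn_ord k)); have := q01 (ltn_ord k).
by move: yq; rewrite in_itv/=; lra.
Qed.

Let step_setT : step setT = 1%E.
Proof.
rewrite stepE (eq_bigr (fun=> (N%:R^-1)%:E)) => [|k _].
  exact: sum_inv.
by rewrite -(q_mass (ltn_ord k)) -itg_EFin// setTI.
Qed.

(** By [x_near] this set is null for [step], so the transport distance is at most [c] almost
    everywhere. *)
Let far : set (measurableTypeR R * measurableTypeR R) :=
  [set z | c < `|z.1 - z.2|].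

Let mdist : measurable_fun [set: (measurableTypeR R * measurableTypeR R)%type]
  (fun z : measurableTypeR R * measurableTypeR R => `|z.1 - z.2| : R).
Proof.
by apply: measurableT_comp => //; exact: measurable_funB.
Qed.

Let step_far : step far = 0%E.
Proof.
rewrite stepE big1// => k _.
rewrite (_ : _ `&` _ = set0) ?integral_set0//.
apply/seteqP; split=> // y [/=]; rewrite /far/= in_itv/= => + /(x_near (ltn_ord k)).
by rewrite ltNge => /negP.
Qed.

Lemma MK1_step_le :
  (MK1 (empirical (fun k : 'I_N => x k)) (density_measure h) <= c%:E)%E.
Proof.
pose P : probability (measurableTypeR R * measurableTypeR R)%type R :=
  HB.pack (step : set _ -> \bar R) (Measure.class step)
    (Measure_isProbability.Build _ _ _ step step_setT).
have PE B : P B = step B by [].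
apply: (@le_trans _ _ (\int[P]_z `|z.1 - z.2|%:E)%E).
  apply: ereal_inf_lbound; exists P => //; split.
  - by rewrite PE step_square.
  - by move=> A mA; rewrite PE step_fst.
  - by move=> A mA; rewrite PE step_snd.
have mfar : measurable far.
  rewrite -[far]setTI; have := mdist.
  move=> /(_ measurableT `]c, +oo[%classic (measurable_itv _)).
  congr (measurable (_ `&` _)); apply/seteqP.
  by split=> z /=; rewrite in_itv/= andbT.
apply: (@le_trans _ _ (\int[P]_z c%:E)%E).
  apply: ae_ge0_le_integral => //.
  - exact/measurable_EFinP.
  - exists far; split=> //.
    move=> z /= H; rewrite /far/= ltNge; apply/negP => zc; apply: H => _.
    by rewrite lee_fin.
by rewrite integral_cst// -[X in (_ * X)%E]/(step setT) step_setT mule1.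
Qed.

End step_coupling.

(** * Taylor expansion of the centroid relations on the cells *)

Lemma is_derive_cubic (R : realType) (x al be ga y : R) :
  is_derive y 1
    (fun z => al * (z - x) + be / 2 * (z - x) ^+ 2 + ga / 3 * (z - x) ^+ 3)
    (al + be * (y - x) + ga * (y - x) ^+ 2).
Proof.
pose Q : {poly R} := 'X - x%:P.
pose P := al *: Q + (be / 2) *: Q ^+ 2 + (ga / 3) *: Q ^+ 3.
have -> : (fun z => al * (z - x) + be / 2 * (z - x) ^+ 2 + ga / 3 * (z - x) ^+ 3)
    = horner P.
  by apply/funext => z; rewrite /P /Q !hornerE.
apply: DeriveDef; first exact: derivable_horner.
rewrite -derive1E -derivE /P !(derivD, derivZ, deriv_exp) /Q.
rewrite !(derivD, derivN, derivX, derivC).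
by rewrite !hornerE /=; field.
Qed.

Lemma quadratic_continuous (R : realType) (x al be ga : R) :
  continuous (fun y => al + be * (y - x) + ga * (y - x) ^+ 2).
Proof.
pose Q : {poly R} := 'X - x%:P.
pose P := al%:P + be *: Q + ga *: Q ^+ 2.
have -> : (fun y => al + be * (y - x) + ga * (y - x) ^+ 2) = horner P.
  by apply/funext => z; rewrite /P /Q !hornerE.
exact: continuous_horner.
Qed.

(** One estimate for all expansions below: the integrands of first moments, the cube root of the
    density, and the density compared with a constant. *)
Lemma itg_approx_quadratic (R : realType) (f : R -> R) (x al be ga c a b : R) :
  continuous f -> a <= b ->
  (forall y, a <= y <= b ->
     `|f y - (al + be * (y - x) + ga * (y - x) ^+ 2)| <= c) ->
  `|itg f a b -
    ((al * (b - x) + be / 2 * (b - x) ^+ 2 + ga / 3 * (b - x) ^+ 3) -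
     (al * (a - x) + be / 2 * (a - x) ^+ 2 + ga / 3 * (a - x) ^+ 3))|
    <= c * (b - a).
Proof.
move=> cf ab; apply: (itg_approx cf _ (is_derive_cubic x al be ga) ab).
exact: quadratic_continuous.
Qed.

(* Near a boundary point the density is nearly 1, so that the two halves of an
   extremal cell have nearly the same length. *)
Lemma extremal_half_cell (R : realType) (rho : R -> R) (x a b e : R) :
  continuous rho -> 0 <= e <= 8^-1 -> 0 <= a -> 0 <= b ->
  (forall y, x - a <= y <= x + b -> `|rho y - 1| <= e) ->
  first_moment rho x (x - a) (x + b) = 0 -> a <= 2 * b /\ b <= 2 * a.
Proof.
move=> cr /andP[e0 e1] a0 b0 re m0.
pose m := Num.max a b.
have am : a <= m by rewrite /m le_max lexx.
have bm : b <= m by rewrite /m le_max lexx orbT.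
have := @itg_approx_quadratic R (fun y => (y - x) * rho y) x 0 1 0 (e * m)
  (x - a) (x + b).
rewrite -/(first_moment rho x (x - a) (x + b)) m0 => H.
have {}H : `|0 - (0 * (x + b - x) + 1 / 2 * (x + b - x) ^+ 2 + 0 / 3 * (x + b - x) ^+ 3 -
   (0 * (x - a - x) + 1 / 2 * (x - a - x) ^+ 2 + 0 / 3 * (x - a - x) ^+ 3))|
    <= e * m * (x + b - (x - a)).
  apply: H; [|lra|].
    apply: continuousM_fun => //; exact: continuous_subr.
  move=> y yab; rewrite mul0r add0r mul1r addr0.
  rewrite -{2}[y - x]mulr1 -mulrBr normrM mulrC ler_pM//; first exact: re.
  rewrite ler_norml; lra.
move: H.
have -> : 0 - (0 * (x + b - x) + 1 / 2 * (x + b - x) ^+ 2 + 0 / 3 * (x + b - x) ^+ 3 -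
   (0 * (x - a - x) + 1 / 2 * (x - a - x) ^+ 2 + 0 / 3 * (x - a - x) ^+ 3))
   = (a ^+ 2 - b ^+ 2) / 2 by field.
have -> : x + b - (x - a) = a + b by ring.
rewrite ler_norml => /andP[H1 H2].
have em : e * m * (a + b) <= 8^-1 * (m * (a + b)).
  by rewrite -mulrA ler_wpM2r// mulr_ge0//; lra.
(* If [b > 2a], then [(b^2 - a^2) / 2] exceeds [3 b^2 / 8], whereas the error is at most
   [3 b^2 / 16]; the other case is symmetric. *)
have [ab|/ltW ba] := leP a b.
  have mb : m = b by rewrite /m max_r.
  split; first lra.
  have [//|ba'] := leP b (2 * a); rewrite mb in em; nra.
have ma : m = a by rewrite /m max_l.
split; last lra.
have [//|ba'] := leP a (2 * b); rewrite ma in em; nra.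
Qed.

(** Taylor expansion at [x] of the moment over the half gaps, and of [r] over the full gaps,
    supplies the hypotheses of [gap_recursion]. The scale [m] stays free, in the form that
    [near_arithmetic] requires. *)
Lemma interior_cell (R : realType) (rho r d : R -> R) (x u v e : R) :
  continuous rho -> continuous r -> 0 <= e <= 1 ->
  (forall y, r y ^+ 3 = rho y) -> (forall y, 2^-1 <= r y <= 3 / 2) ->
  2^-1 <= rho x ->
  (forall x y, 0 <= x <= 1 -> 0 <= y <= 1 -> `|rho y - rho x| <= e * `|y - x|) ->
  (forall x y, 0 <= x <= 1 -> 0 <= y <= 1 ->
      `|rho y - rho x - d x * (y - x)| <= e * (y - x) ^+ 2) ->
  `|d x| <= e -> 0 <= u -> 0 <= v -> 0 <= x - u -> x + v <= 1 ->
  first_moment rho x (x - u / 2) (x + v / 2) = 0 ->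
  forall m, u <= m -> v <= m -> m <= u + v ->
  `|itg r x (x + v) - itg r (x - u) x| <= 2800 * e * m ^+ 3.
Proof.
move=> cr cr3 /andP[e0 e1] r3 rb rx lip tay dx u0 v0 xu xv m0 m um vm muv.
have x01 : 0 <= x <= 1 by lra.
have hr : 0 <= m by lra.
have root y : 0 <= y <= 1 -> x - m <= y <= x + m ->
    `|r y - (r x + d x / (3 * r x ^+ 2) * (y - x) + 0 * (y - x) ^+ 2)| <= 16 * e * m ^+ 2.
  move=> y01 ym; rewrite mul0r addr0.
  apply: (@le_trans _ _ (16 * e * (y - x) ^+ 2)).
    apply: cube_root_taylor; rewrite ?r3.
    - by have := rb x; lra.
    - by have := rb y; lra.
    - by rewrite e0 e1.
    - exact: lip.
    - exact: tay.
  rewrite ler_wpM2l ?mulr_ge0// -(real_normK (num_real (y - x))).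
  by rewrite ler_pXn2r ?nnegrE// ler_norml; lra.
have m3 : 0 <= 16 * e * m ^+ 2 by rewrite !mulr_ge0// exprn_ge0.
apply: (@gap_recursion R (r x) (d x) u v e m) => //.
- by rewrite u0.
- by rewrite v0.
- by lra.
- by rewrite e0.
- by have /andP[] := rb x.
- by rewrite r3.
(* The half gaps produce the denominators: 8 = 2 * 2^2 and 24 = 3 * 2^3. *)
- have := @itg_approx_quadratic R (fun y => (y - x) * rho y) x 0 (rho x) (d x)
    (e * m ^+ 3) (x - u / 2) (x + v / 2).
  have cm : continuous (fun y => (y - x) * rho y).
    by apply: continuousM_fun => //; exact: continuous_subr.
  have uv : x - u / 2 <= x + v / 2 by lra.
  rewrite -/(first_moment rho x _ _) m0 => /(_ cm uv) H.
  rewrite r3 -normrN.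
  apply: (le_trans (le_trans _ (H _))).
  + rewrite le_eqVlt; apply/orP; left; apply/eqP; congr `|_|; by field.
  + move=> y yuv; have ym : `|y - x| <= m by rewrite ler_norml; lra.
    have -> : (y - x) * rho y - (0 + rho x * (y - x) + d x * (y - x) ^+ 2) =
      (y - x) * (rho y - rho x - d x * (y - x)) by ring.
    rewrite normrM (_ : e * m ^+ 3 = m * (e * m ^+ 2)); last by ring.
    rewrite ler_pM//; apply: (le_trans (tay x y x01 _)); first by lra.
    rewrite ler_wpM2l// -(real_normK (num_real (y - x))).
    by rewrite ler_pXn2r ?nnegrE.
  + rewrite (_ : e * m ^+ 4 = e * m ^+ 3 * m); last by ring.
    by rewrite ler_wpM2l ?mulr_ge0 ?exprn_ge0//; lra.
- have := @itg_approx_quadratic R r x (r x) (d x / (3 * r x ^+ 2)) 0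
    (16 * e * m ^+ 2) x (x + v).
  have xv' : x <= x + v by lra.
  move=> /(_ cr3 xv') H.
  apply: (le_trans (le_trans _ (H _))).
  + rewrite le_eqVlt; apply/orP; left; apply/eqP; congr `|_|.
    by set s := _ / (3 * _); field.
  + by move=> y yv; apply: root; lra.
  + rewrite (_ : 16 * e * m ^+ 3 = 16 * e * m ^+ 2 * m); last by ring.
    by rewrite ler_wpM2l//; lra.
- have := @itg_approx_quadratic R r x (r x) (d x / (3 * r x ^+ 2)) 0
    (16 * e * m ^+ 2) (x - u) x.
  have xu' : x - u <= x by lra.
  move=> /(_ cr3 xu') H.
  apply: (le_trans (le_trans _ (H _))).
  + rewrite le_eqVlt; apply/orP; left; apply/eqP; congr `|_|.
    by set s := _ / (3 * _); field.
  + by move=> y yv; apply: root; lra.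
  + rewrite (_ : 16 * e * m ^+ 3 = 16 * e * m ^+ 2 * m); last by ring.
    by rewrite ler_wpM2l//; lra.
Qed.

(** Minimality enters only through the centroid relations. [interior_cell] gives the recursion for
    [near_arithmetic], and [extremal_half_cell] controls its two ends. *)
Lemma critical_points_near_quantiles (R : realType) (rho r d : R -> R) (e : R)
    (n : nat) (X : nat -> R) :
  continuous rho -> continuous r -> 0 <= e <= (32 * 2800)^-1 ->
  (forall y, r y ^+ 3 = rho y) -> (forall y, 2^-1 <= r y <= 3 / 2) ->
  (forall y, 0 <= y <= 1 -> `|rho y - 1| <= e) ->
  (forall x y, 0 <= x <= 1 -> 0 <= y <= 1 -> `|rho y - rho x| <= e * `|y - x|) ->
  (forall x y, 0 <= x <= 1 -> 0 <= y <= 1 ->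
      `|rho y - rho x - d x * (y - x)| <= e * (y - x) ^+ 2) ->
  (forall x, 0 <= x <= 1 -> `|d x| <= e) ->
  (0 < n)%N ->
  (forall i, (i <= n)%N -> 0 <= X i <= 1) ->
  (forall i, (i < n)%N -> X i <= X i.+1) ->
  (forall i, (i.+1 < n)%N -> first_moment rho (X i.+1)
     ((X i + X i.+1) / 2) ((X i.+1 + X i.+2) / 2) = 0) ->
  first_moment rho (X 0%N) 0 ((X 0%N + X 1%N) / 2) = 0 ->
  first_moment rho (X n) ((X n.-1 + X n) / 2) 1 = 0 ->
  forall k, (k <= n)%N ->
    `|itg r 0 (X k) - k%:R * (itg r 0 1 / n.+1%:R)| <= 64 / n.+1%:R.
Proof.
move=> cr cr3 /andP[e0 e1] r3 rb r1 lip tay dx n0 X01 Xmono Hin H0 Hn.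
have chas a b : 0 <= a -> a <= b -> itg r 0 b - itg r 0 a = itg r a b.
  by move=> a0 ab; rewrite (itg_chasles cr3 a0 ab) addrAC subrr add0r.
have cc (k : R) : continuous (fun _ : R => k) by exact: cst_continuous.
have ilo a b : a <= b -> (b - a) / 2 <= itg r a b.
  move=> ab; rewrite mulrC -(itg_cst 2^-1 ab); apply: itg_le => // y _.
  by have /andP[] := rb y.
have ihi a b : a <= b -> itg r a b <= 3 / 2 * (b - a).
  move=> ab; rewrite -(itg_cst (3 / 2) ab); apply: itg_le => // y _.
  by have /andP[] := rb y.
(* The bound on [e] is chosen to make [2800 e] at most 1/32. *)
apply: (@near_arithmetic R n X (fun k => itg r 0 (X k)) (2800 * e)) => //.
- lra.
- by have := ihi 0 1 ler01; lra.
- move=> i iN; have Xi := Xmono i iN; have /andP[x0 _] := X01 i (ltnW iN).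
  by rewrite (chas _ _ x0 Xi); have := ilo _ _ Xi; lra.
- move=> i m iN um vm muv.
  have Xi := Xmono i (ltnW iN); have Xi1 := Xmono i.+1 iN.
  have /andP[x0 _] := X01 i (ltnW (ltnW iN)).
  have /andP[_ x1] := X01 i.+2 iN.
  rewrite (chas _ _ x0 Xi) chas//; last by apply: le_trans Xi.
  have := @interior_cell R rho r d (X i.+1) (X i.+1 - X i) (X i.+2 - X i.+1) e.
  rewrite !subKr [X i.+1 + (X i.+2 - X i.+1)]addrCA subrr addr0 => H.
  have {H}-> // := H; rewrite ?subr_ge0//; try lra.
  + have := X01 i.+1 (ltnW iN) => /r1; rewrite ler_norml; lra.
  + exact: dx (X01 _ (ltnW iN)).
  + rewrite -[RHS](Hin i iN); congr first_moment; lra.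
(* The first cell has half lengths [X 0] and [(X 1 - X 0) / 2], so [X 0 <= X 1 - X 0]. The factor 3
   is the ratio of the bounds 3/2 and 1/2 on [r]. *)
- have /andP[x0 _] := X01 0%N isT; have X1 := Xmono 0%N n0.
  have /andP[_ x1] := X01 1%N n0.
  have [] := @extremal_half_cell R rho (X 0%N) (X 0%N)
    ((X 1%N - X 0%N) / 2) e cr; [lra|lra|lra| | |].
  + by move=> y; rewrite subrr => yX; apply: r1; lra.
  + by rewrite -[RHS]H0 subrr; congr first_moment; lra.
  + move=> h _; have := ihi _ _ x0; have := ilo _ _ x0; have := ilo _ _ X1.
    rewrite (chas _ _ x0 X1); lra.
- have /andP[_ x1] := X01 n (leqnn n).
  have nn : (n.-1 < n)%N by rewrite prednK.
  have := Xmono _ nn; rewrite prednK// => Xn.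
  have /andP[x0 _] := X01 n.-1 (ltnW nn).
  have [] := @extremal_half_cell R rho (X n) ((X n - X n.-1) / 2)
    (1 - X n) e cr; [lra|lra|lra| | |].
  + by move=> y yX; apply: r1; lra.
  + by rewrite -[RHS]Hn; congr first_moment; lra.
  + move=> _ h; have := ihi _ _ x1; have := ilo _ _ x1; have := ilo _ _ Xn.
    rewrite (chas _ _ x0 Xn) chas//; last exact: le_trans Xn.
    lra.
Qed.

(** * Cells of a sorted minimizer *)

Lemma le_dist_left (R : realFieldType) (a b y : R) :
  a <= b -> (a + b) / 2 <= y -> `|b - y| <= `|a - y|.
Proof.
move=> ab yab; have := ler_norm (y - a); rewrite distrC.
by move=> H; rewrite ler_norml; apply/andP; split; lra.
Qed.

Lemma le_dist_right (R : realFieldType) (a b y : R) :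
  a <= b -> y <= (a + b) / 2 -> `|a - y| <= `|b - y|.
Proof.
move=> ab yab; have := ler_norm (b - y).
by move=> H; rewrite ler_norml; apply/andP; split; lra.
Qed.

(** In sorted order only the neighbours delimit a cell. Coinciding points do no harm, since
    [minimizer_first_moment] asks only for weak inequalities between distances. *)
Lemma sorted_cell_first_moment (R : realType) (rho rho' : R -> R) (n : nat)
    (X : nat -> R) (k : nat) :
  continuous rho' -> (forall y, 0 <= y <= 1 -> rho y = rho' y) ->
  (forall y, 0 <= rho' y) -> itg rho' 0 1 = 1 ->
  quant_minimizer rho (fun i : 'I_n.+1 => X i) ->
  (forall i j, (i <= j <= n)%N -> X i <= X j) ->
  (k <= n)%N ->
  first_moment rho' (X k)
    (if k is k'.+1 then (X k' + X k) / 2 else 0)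
    (if (k < n)%N then (X k + X k.+1) / 2 else 1) = 0.
Proof.
move=> cr Er r0 r1 mX mono kn.
have X01 i : (i <= n)%N -> 0 <= X i <= 1.
  move=> iN; have iN' : (i < n.+1)%N by [].
  by have := mX.1 (Ordinal iN'); rewrite in_itv.
set a := (if k is _.+1 then _ else _); set b := (if (k < n)%N then _ else _).
have ak : 0 <= a <= X k.
  rewrite /a; case: (k) kn => [|k'] k'n; first by have := X01 0%N k'n; lra.
  have := X01 k' (ltnW k'n); have := X01 _ k'n.
  by have := mono k' k'.+1; rewrite leqnSn k'n => /(_ isT); lra.
have bk : X k <= b <= 1.
  rewrite /b; case: ifPn => kn'; last by have := X01 _ kn; lra.
  have := X01 _ kn; have := X01 _ kn'.
  by have := mono k k.+1; rewrite leqnSn kn' => /(_ isT); lra.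
have kn1 : (k < n.+1)%N by [].
apply: (@minimizer_first_moment R rho rho' n.+1 (fun i => X i) (Ordinal kn1)) => //=.
- by case/andP: ak.
- lra.
- by case/andP: bk.
- move=> y /andP[ay yb] j; have jn : (j <= n)%N by rewrite -ltnS.
  have [jk|kj|->//] := ltngtP j k.
    have H : X j <= X k by apply: mono; rewrite (ltnW jk).
    apply: le_dist_left => //; apply: le_trans ay.
    rewrite /a; case: (k) jk kn => [//|k'] jk kn'.
    have : X j <= X k' by apply: mono; rewrite -ltnS jk ltnW.
    lra.
  have H : X k <= X j by apply: mono; rewrite (ltnW kj).
  apply: le_dist_right => //; apply: (le_trans yb).
  rewrite /b (leq_trans kj jn).
  have : X k.+1 <= X j by apply: mono; rewrite kj.
  lra.
- rewrite /a; case: (k) kn kn1 => [|k'] kn' kn1'; first by rewrite ltxx.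
  move=> _; have k'n : (k' < n.+1)%N by exact: ltnW.
  exists (Ordinal k'n); first by rewrite -val_eqE/= ltn_eqF.
  move=> y /andP[_ yk] /=; apply: le_dist_right => //; apply: mono.
  by rewrite leqnSn.
- rewrite /b; case: ifPn => kn'; last by rewrite ltxx.
  move=> _; have k'n : (k.+1 < n.+1)%N by [].
  exists (Ordinal k'n); first by rewrite -val_eqE/= gtn_eqF.
  move=> y /andP[yk _] /=; apply: le_dist_left => //; apply: mono.
  by rewrite leqnSn.
Qed.

(** * Quantiles, reordering of the points and the transport bound *)

Lemma lipschitz_fun_continuous (R : realType) (f : R -> R) (K : R) :
  (forall x y, `|f y - f x| <= K * `|y - x|) -> continuous f.
Proof.
move=> fK x; apply/cvgrPdist_lt => e e0.
have K0 : 0 < `|K| + 1 by rewrite ltr_pwDr.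
near=> y.
rewrite distrC; apply: (le_lt_trans (fK x y)).
apply: (@le_lt_trans _ _ ((`|K| + 1) * `|y - x|)).
  by rewrite ler_wpM2r// (le_trans (ler_norm K))// lerDl.
rewrite mulrC -ltr_pdivlMr// distrC; near: y.
by apply: cvgr_dist_lt; [exact: cvg_id|rewrite divr_gt0].
Unshelve. all: by end_near. Qed.

(** The primitive of [r] takes the required values by the intermediate value theorem. Its slope of
    at least 1/2 gives the order of the quantiles and their values at both ends. *)
Lemma exists_quantiles (R : realType) (r : R -> R) (N : nat) :
  continuous r -> (forall y, 2^-1 <= r y) -> (0 < N)%N ->
  exists q : nat -> R, [/\ q 0%N = 0, q N = 1,
    forall k, (k < N)%N -> q k <= q k.+1,
    forall k, (k <= N)%N -> 0 <= q k <= 1 &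
    forall k, (k <= N)%N -> itg r 0 (q k) = k%:R * (itg r 0 1 / N%:R)].
Proof.
move=> cr rb N0; set L := itg r 0 1.
have NR : 0 < N%:R :> R by rewrite ltr0n.
have ilo a b : 0 <= a -> a <= b -> itg r 0 a + (b - a) / 2 <= itg r 0 b.
  move=> a0 ab; rewrite (itg_chasles cr a0 ab) lerD2l.
  by rewrite mulrC -(itg_cst 2^-1 ab); apply: itg_le => // y; exact: cst_continuous.
have L0 : 0 <= L.
  by have := ilo 0 1 (lexx 0) ler01; rewrite itg_point -/L; lra.
have cG : {within `[0, 1], continuous (itg r 0)}.
  apply: parameterized_integral_continuous => //; exact: itg_integrable.
have qex (k : nat) : exists t : R, (k <= N)%N ->
    0 <= t <= 1 /\ itg r 0 t = k%:R * (L / N%:R).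
  have [kN|_] := leqP k N; last by exists 0.
  have [|t] := @IVT R (itg r 0) 0 1 (k%:R * (L / N%:R)) ler01 cG.
    rewrite itg_point -/L (min_idPl L0) (max_idPr L0); apply/andP; split.
      by rewrite mulr_ge0// divr_ge0// ltW.
    by rewrite mulrCA ler_piMr// ler_pdivrMr// mul1r ler_nat.
  by rewrite in_itv/= => t01 Ht; exists t.
have [q Hq] := choice qex; exists q.
have q01 k : (k <= N)%N -> 0 <= q k <= 1 by move=> /Hq [].
have qE k : (k <= N)%N -> itg r 0 (q k) = k%:R * (L / N%:R) by move=> /Hq [].
split=> //.
- have := ilo 0 (q 0%N) (lexx 0); have /andP[a _] := q01 0%N (leq0n N).
  by move=> /(_ a); rewrite itg_point qE// mul0r; lra.
- have /andP[a b] := q01 N (leqnn N); have := ilo (q N) 1 a b.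
  by rewrite qE// mulrC divfK ?gt_eqF// -/L; lra.
- move=> k kN; have [//|qq] := leP (q k) (q k.+1).
  have /andP[a _] := q01 _ kN.
  have := ilo _ _ a (ltW qq); rewrite !qE//; last exact: ltnW.
  have : k%:R * (L / N%:R) <= k.+1%:R * (L / N%:R).
    by rewrite ler_wpM2r ?ler_nat// divr_ge0// ltW.
  lra.
Qed.

Lemma sorting_perm (R : realDomainType) (n : nat) (x : 'I_n -> R) :
  exists p : {perm 'I_n}, forall i j : 'I_n, (i <= j)%N -> x (p i) <= x (p j).
Proof.
pose t := [tuple x i | i < n].
have [p Hp] : exists p : {perm 'I_n}, sort <=%R t = [tuple tnth t (p i) | i < n].
  by apply/tuple_permP; rewrite perm_sort.
exists p => i j ij.
have E k : x (p k) = nth 0 (sort <=%R t) k.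
  by rewrite Hp -tnth_nth !tnth_mktuple.
rewrite !E; apply: le_sorted_leq_nth => //; first exact: sort_le_sorted.
  by rewrite inE size_sort size_tuple.
by rewrite inE size_sort size_tuple.
Qed.

(** The cost depends on the points only through a minimum, which ignores their order. *)
Lemma minimizer_perm (R : realType) (rho rho' : R -> R) (N : nat) (x : 'I_N -> R)
    (p : {perm 'I_N}) :
  (0 < N)%N -> continuous rho' -> (forall y, 0 <= y <= 1 -> rho y = rho' y) ->
  quant_minimizer rho x -> quant_minimizer rho (x \o p).
Proof.
move=> N0 cr Er [x01 xmin]; split=> [i|z z01]; first exact: x01.
apply: (le_trans _ (xmin z z01)).
have {}x01 j : 0 <= x j <= 1 by have := x01 j; rewrite in_itv.
have xp01 i : 0 <= (x \o p) i <= 1 by exact: x01.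
rewrite (quantF_itg N0 cr Er x01) (quantF_itg N0 cr Er xp01) lee_fin.
rewrite (_ : min_sqdist (x \o p) = min_sqdist x)//.
apply/funext => y; apply/eqP; rewrite eq_le; apply/andP; split; apply: le_min_sqdist.
- exact: bigmin_le_id.
- move=> i; apply: (le_trans (min_sqdist_le _ _ (p^-1%g i))).
  by rewrite /= permKV.
- exact: bigmin_le_id.
- by move=> i; exact: min_sqdist_le.
Qed.

Lemma empirical_perm (R : realType) (N : nat) (x : 'I_N -> R) (p : {perm 'I_N}) :
  empirical (x \o p) = empirical x.
Proof.
apply/funext => A; rewrite /empirical [in RHS](reindex_inj (@perm_inj _ p)).
by [].
Qed.

Lemma cube_root_bounds (R : realFieldType) (a : R) :
  0 <= a -> 2^-1 <= a ^+ 3 <= 3 / 2 -> 2^-1 <= a <= 3 / 2.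
Proof.
move=> a0 /andP[a1 a2]; apply/andP; split.
  have [//|h] := leP (2^-1) a.
  have : a ^+ 3 <= (2^-1) ^+ 3 by rewrite ler_pXn2r ?nnegrE//; lra.
  lra.
have [//|h] := leP a (3 / 2).
have : (3 / 2) ^+ 3 <= a ^+ 3 by rewrite ler_pXn2r ?nnegrE//; lra.
lra.
Qed.

Lemma cube_root_lip (R : realFieldType) (a b : R) :
  2^-1 <= a -> 2^-1 <= b -> `|b - a| <= 2 * `|b ^+ 3 - a ^+ 3|.
Proof.
move=> a1 b1.
have -> : b ^+ 3 - a ^+ 3 = (b - a) * (a ^+ 2 + a * b + b ^+ 2) by ring.
have : 2^-1 <= a ^+ 2 + a * b + b ^+ 2 by nra.
set w := _ + b ^+ 2 => h; rewrite normrM (ger0_norm (_ : 0 <= w)); last lra.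
by have := normr_ge0 (b - a); nra.
Qed.

(** Here [w] is 1/N, while [s] and [t] are the values of the primitive at the [k]-th point and
    inside the [k]-th quantile interval, over which it grows by at most [2 w]; hence 66 = 64 + 2. *)
Lemma quantile_shift (R : realFieldType) (k L w s t : R) :
  `|s - k * (L * w)| <= 64 * w -> L * w <= 2 * w ->
  k * (L * w) <= t <= (k + 1) * (L * w) -> `|s - t| <= 66 * w.
Proof.
rewrite [(k + 1) * _]mulrDl mul1r; move: (L * w) => v; move: (k * v) => u.
rewrite !ler_norml => /andP[h1 h2] h3 /andP[h4 h5].
by apply/andP; split; lra.
Qed.

Lemma itg_lower (R : realType) (f : R -> R) (c a b : R) : continuous f ->
  (forall y, c <= f y) -> a <= b -> c * (b - a) <= itg f a b.
Proof.
move=> cf cle ab; rewrite -(itg_cst c ab); apply: itg_le => // y.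
exact: cst_continuous.
Qed.

Lemma itg_upper (R : realType) (f : R -> R) (c a b : R) : continuous f ->
  (forall y, f y <= c) -> a <= b -> itg f a b <= c * (b - a).
Proof.
move=> cf fle ab; rewrite -(itg_cst c ab); apply: itg_le => // y.
exact: cst_continuous.
Qed.

(* A coupling of the two measures is obtained by sending the mass between two
   consecutive [1/N]-quantiles of the limit density to a single point. *)
Lemma MK1_near_quantiles (R : realType) (r : R -> R) (n : nat) (X : nat -> R) :
  continuous r -> (forall y, 2^-1 <= r y) -> itg r 0 1 <= 2 ->
  (forall k, (k <= n)%N -> 0 <= X k <= 1) ->
  (forall k, (0 < n)%N -> (k <= n)%N ->
     `|itg r 0 (X k) - k%:R * (itg r 0 1 / n.+1%:R)| <= 64 / n.+1%:R) ->
  (MK1 (empirical (fun i : 'I_n.+1 => X i))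
     (density_measure (fun t => (itg r 0 1)^-1 * r t)%R) <= (132 / n.+1%:R)%:E)%E.
Proof.
move=> cr rlo L2 X01 Xq.
have L_lo := itg_lower cr rlo ler01.
have [q [q0 qN q_le q01 qE]] := exists_quantiles cr rlo (ltn0Sn n).
have mass a b : 0 <= a -> a <= b -> b - a <= 2 * (itg r 0 b - itg r 0 a).
  move=> a0 ab; have := itg_lower cr rlo ab; rewrite (itg_chasles cr a0 ab); lra.
have q_mass k : (k < n.+1)%N ->
    itg r (q k) (q k.+1) = itg r 0 1 / n.+1%:R.
  move=> kN; have /andP[qk0 _] := q01 _ (ltnW kN).
  have := itg_chasles cr qk0 (q_le k kN).
  rewrite (qE _ kN) (qE _ (ltnW kN)) -[k.+1%:R]natr1 [(k%:R + 1) * _]mulrDl mul1r.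
  by move=> /addrI.
move: L2 L_lo Xq qE q_mass; set L := itg r 0 1 => L2 L_lo Xq qE q_mass.
have N0 : 0 <= n.+1%:R^-1 :> R by rewrite invr_ge0.
have L0 : 0 < L by lra.
have ch : continuous (fun t => L^-1 * r t).
  by apply: continuousM_fun cr; exact: cst_continuous.
have h0 t : 0 <= L^-1 * r t.
  apply: mulr_ge0; first by rewrite invr_ge0 ltW.
  by apply: le_trans (rlo t); lra.
apply: (MK1_step_le ch h0 (q := q)) => //.
- by move=> k kN; rewrite itgZ// q_mass// mulrA mulVf ?mul1r// gt_eqF.
move=> k y kN /andP[qy yq]; have /andP[X0 X1] := X01 k kN.
have /andP[q0' _] := q01 _ (ltnW kN); have /andP[_ q1'] := q01 _ kN.
have y0 : 0 <= y by apply: le_trans qy.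
(* A single point has no neighbour, so [Xq] is silent; any two points of [[0, 1]] are within 132 of
   each other. *)
have [n0|n0] := posnP n.
  by rewrite n0 divr1 ler_norml; lra.
have G1 := mass _ _ q0' qy; have G2 := mass _ _ y0 yq.
rewrite (qE _ (ltnW kN)) in G1; rewrite (qE _ kN) -[k.+1%:R]natr1 in G2.
have LN : L / n.+1%:R <= 2 / n.+1%:R by exact: ler_wpM2r.
have Gy : k%:R * (L / n.+1%:R) <= itg r 0 y <= (k%:R + 1) * (L / n.+1%:R).
  move: G1 G2; move: (k%:R * (L / _)) ((k%:R + 1) * (L / _)) (itg r 0 y) => u w v.
  by move=> G1 G2; apply/andP; split; lra.
have := quantile_shift (Xq k n0 kN) LN Gy.
(* Since [1/2 <= r], distances are at most twice the increments of the primitive; hence 132 = 2 *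
   66. *)
have XG : `|X k - y| <= 2 * `|itg r 0 (X k) - itg r 0 y|.
  have [Xy|/ltW yX] := leP (X k) y.
    rewrite distrC [X in 2 * X]distrC ger0_norm ?subr_ge0//.
    by apply: (le_trans (mass _ _ X0 Xy)); rewrite ler_wpM2l// ler_norm.
  rewrite ger0_norm ?subr_ge0//.
  by apply: (le_trans (mass _ _ y0 yX)); rewrite ler_wpM2l// ler_norm.
move: XG; set v := n.+1%:R^-1; lra.
Qed.

(** * Extension of the density to the line, and conclusion *)

Definition clamp {R : realType} (y : R) : R := Num.max 0 (Num.min 1 y).

Lemma clamp01 (R : realType) (y : R) : 0 <= clamp y <= 1.
Proof. by rewrite /clamp le_max lexx/= ge_max ler01/= ge_min lexx. Qed.

Lemma clamp_id (R : realType) (y : R) : 0 <= y <= 1 -> clamp y = y.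
Proof. by move=> /andP[y0 y1]; rewrite /clamp min_r// max_r. Qed.

Lemma clamp_lip (R : realType) (y z : R) : `|clamp z - clamp y| <= `|z - y|.
Proof.
have clamp3 (t : R) : [\/ t <= 0 /\ clamp t = 0, 0 <= t <= 1 /\ clamp t = t |
    1 <= t /\ clamp t = 1].
  have [t0|t0] := leP t 0.
    by constructor 1; rewrite /clamp min_r ?max_l// (le_trans t0).
  have [t1|t1] := leP t 1; first by constructor 2; rewrite clamp_id// ltW.
  by constructor 3; rewrite /clamp min_l ?max_r// ltW.
have h1 := ler_norm (z - y).
have h2 : y - z <= `|z - y| by rewrite distrC ler_norm.
rewrite ler_norml; set w := `|z - y| in h1 h2 *.
by case: (clamp3 y) => -[? ->]; case: (clamp3 z) => -[? ->]; lra.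
Qed.

Lemma cube_root_powR (R : realType) (a : R) : 0 <= a -> (a `^ 3^-1) ^+ 3 = a.
Proof.
by move=> a0; rewrite -powR_mulrn ?powR_ge0// -powRrM mulVf// powRr1.
Qed.

Lemma cube_root_continuous (R : realType) (f r : R -> R) (K : R) :
  (forall x y, `|f y - f x| <= K * `|y - x|) ->
  (forall y, r y ^+ 3 = f y) -> (forall y, 2^-1 <= r y) -> continuous r.
Proof.
move=> fK r3 rlo; apply: (@lipschitz_fun_continuous R r (2 * K)) => y z.
apply: (le_trans (cube_root_lip (rlo y) (rlo z))).
by rewrite !r3 -mulrA ler_wpM2l.
Qed.

(** The mean of [f] over the unit interval is 1, and there [f] differs from [f y] by at most [e]. *)
Lemma lip_mean_near (R : realType) (f : R -> R) (e : R) : continuous f -> 0 <= e ->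
  (forall x y, `|f y - f x| <= e * `|y - x|) -> itg f 0 1 = 1 ->
  forall y, 0 <= y <= 1 -> `|f y - 1| <= e.
Proof.
move=> cf e0 fK I1 y y01.
have := @itg_approx_quadratic R f 0 (f y) 0 0 e 0 1 cf ler01.
rewrite I1 !mul0r !addr0 !subr0 !mulr1 mulr0 subr0 distrC; apply.
move=> z z01; rewrite !mul0r !addr0; apply: (le_trans (fK _ _)).
by rewrite -[leRHS]mulr1 ler_wpM2l// ler_norml; lra.
Qed.

Unset Implicit Arguments.
Set Strict Implicit.

Theorem corollary1p3 (R : realType) :
  exists eps : R, exists C : R, 0 < eps /\ 0 < C /\
  forall rho : R -> R,
    smooth01 rho ->
    prob_density rho ->
    bounded_above rho ->
    bounded_away_from_zero rho ->
    (supnorm (within_derive rho) + supnorm (within_derive (within_derive rho))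
       <= eps%:E)%E ->
  forall (N : nat) (x : 'I_N -> R),
    (1 <= N)%N ->
    quant_minimizer rho x ->
    (MK1 (empirical x) (density_measure (limit_density rho))
       <= (C / N%:R)%:E)%E.
Proof.
(* The bound 1/8 keeps the density between 1/2 and 3/2; the smaller bound makes [near_arithmetic]
   applicable. *)
have [e [e0 e1 e2]] : exists e : R,
    [/\ 0 < e, e <= 8^-1 & 0 <= e <= (32 * 2800)^-1].
  by exists (32 * 2800)^-1; split; lra.
exists e, 132; split; first exact: e0.
split=> // rho srho [_ rhoI] _ _ He [//|n] x _ mx.
have [d1 lip tay] := smooth_taylor srho He.
have {}e0 := ltW e0.
(* Nothing is known of [rho] outside [[0, 1]]; composing with the projection gives a function that
   is Lipschitz on the whole line. *)
pose rho' y := rho (clamp y).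
have Er y : 0 <= y <= 1 -> rho y = rho' y by move=> /clamp_id; rewrite /rho' => ->.
have lip' y z : `|rho' z - rho' y| <= e * `|z - y|.
  apply: (le_trans (lip _ _ (clamp01 y) (clamp01 z))).
  by apply: ler_wpM2l => //; exact: clamp_lip.
have cr : continuous rho' := lipschitz_fun_continuous lip'.
have I1 : itg rho' 0 1 = 1.
  apply/EFin_inj; rewrite -itg_EFin// -rhoI; apply: eq_integral => y.
  by rewrite inE/= in_itv/= => y01; rewrite Er.
have near1 := lip_mean_near cr e0 lip' I1.
have rhob y : 2^-1 <= rho' y <= 3 / 2.
  have := near1 _ (clamp01 y); rewrite /rho' (clamp_id (clamp01 y)) ler_norml.
  by move: (rho _) e1 => t; lra.
have rho'0 y : 0 <= rho' y by have := rhob y; move: (rho' y) => t; lra.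
pose r y := rho' y `^ 3^-1.
have r3 y : r y ^+ 3 = rho' y by exact: cube_root_powR.
have rb y : 2^-1 <= r y <= 3 / 2.
  by apply: cube_root_bounds; [exact: powR_ge0|rewrite r3; exact: rhob].
have rlo y : 2^-1 <= r y by have /andP[] := rb y.
have rhi y : r y <= 3 / 2 by have /andP[] := rb y.
have cr3 : continuous r := cube_root_continuous lip' r3 rlo.
have Eh : density_measure (limit_density rho) =
    density_measure (fun t => (itg r 0 1)^-1 * r t).
  have EL : limit_constant rho = (itg r 0 1)^-1.
    congr (_^-1); apply: eq_itg => t t01; congr (_ `^ _); exact: Er.
  apply/funext => A; apply: eq_integral => y.
  rewrite inE => -[_ /=]; rewrite in_itv/= => y01; congr (_ %:E).
  by rewrite /limit_density EL (Er y y01).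
have [p psort] := sorting_perm x.
(* Indices above [n] are sent to a default ordinal and do not enter the estimates. *)
pose X k := x (p (inord k)).
have XE : (fun i : 'I_n.+1 => X i) = x \o p.
  by apply/funext => i; rewrite /X inord_val.
have Xmono i j : (i <= j <= n)%N -> X i <= X j.
  move=> /andP[ij jn]; apply: psort.
  by rewrite !inordK ?ltnS// (leq_trans ij).
have mX : quant_minimizer rho (fun i : 'I_n.+1 => X i).
  rewrite XE; exact: (minimizer_perm p (ltn0Sn n) cr Er mx).
have X01 k : (k <= n)%N -> 0 <= X k <= 1.
  by move=> _; have := mx.1 (p (inord k)); rewrite in_itv.
have cellM k := sorted_cell_first_moment (k := k) cr Er rho'0 I1 mX Xmono.
rewrite Eh -(empirical_perm x p) -XE.
clearbody X; clear XE mX psort x mx p Eh.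
apply: (MK1_near_quantiles cr3 rlo _ X01).
  by apply: (le_trans (itg_upper cr3 rhi ler01)); lra.
move=> k n0; move: k.
have lip01 a b : 0 <= a <= 1 -> 0 <= b <= 1 ->
  `|rho' b - rho' a| <= e * `|b - a| by move=> _ _; exact: lip'.
have tay01 a b : 0 <= a <= 1 -> 0 <= b <= 1 ->
    `|rho' b - rho' a - within_derive rho a * (b - a)| <= e * (b - a) ^+ 2.
  by move=> a01 b01; rewrite -(Er a a01) -(Er b b01); exact: tay.
apply: (critical_points_near_quantiles
  cr cr3 e2 r3 rb near1 lip01 tay01 d1 n0 X01).
- by move=> i iN; apply: Xmono; rewrite leqnSn.
- by move=> i iN; have := cellM i.+1 (ltnW iN); rewrite iN.
- by have := cellM 0%N (leq0n n); rewrite n0.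
- by have := cellM n (leqnn n); rewrite ltnn; case: (n) n0.
Qed.
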